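(* Let $\mathcal S$ be a set of $K$-armed exponential family bandit models such that every $\boldsymbol\mu\in\mathcal S$ has a unique optimal arm $a^*(\boldsymbol\mu)$. Let $\delta\in(0,1)$. For any strategy that is $\delta$-PAC on $\mathcal S$ and any bandit model $\boldsymbol\mu\in\mathcal S$, $$\mathbb E_{\boldsymbol\mu}[\tau_\delta]\ \ge\ T^*(\boldsymbol\mu)\,\mathrm{kl}(\delta,1-\delta),$$ where $$T^*(\boldsymbol\mu)^{-1}:=\sup_{w\in\Sigma_K}\ \inf_{\boldsymbol\lambda\in\mathrm{Alt}(\boldsymbol\mu)}\left(\sum_{a=1}^K w_a\,d(\mu_a,\lambda_a)\right).$$
   Context: Let $\mathcal A=\{1,\dots,K\}$ be the set of arms. Exponential family: $\Theta\subset\mathbb R$, $\xi$ is a reference measure on $\mathbb R$, $b:\Theta\to\mathbb R$ is convex and twice differentiable, and $\nu_\theta$ ($\theta\in\Theta$) is the probability distribution with density $\frac{d\nu_\theta}{d\xi}(x)=\exp(\theta x-b(\theta))$. Its mean is $\dot b(\theta)$, and for each $\mu\in\dot b(\Theta)$, $\nu^\mu$ denotes the unique distribution of the family with mean $\mu$. The divergence function is $d(\mu,\mu')=\mathrm{KL}(\nu^\mu,\nu^{\mu'})=b(\theta')-b(\theta)-\dot b(\theta)(\theta'-\theta)$ when $\mu=\dot b(\theta)$, $\mu'=\dot b(\theta')$. A $K$-armed exponential family bandit model $(\nu^{\mu_1},\dots,\nu^{\mu_K})$ is identified with the vector of means $\boldsymbol\mu=(\mu_1,\dots,\mu_K)$.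 At each time $t=1,2,\dots$ an arm $A_t\in\mathcal A$ is chosen and a new independent reward $X_t$ is drawn from $\nu^{\mu_{A_t}}$; $\mathcal F_t=\sigma(X_1,\dots,X_t)$. Probabilities and expectations under the model $\boldsymbol\mu$ are written $\mathbb P_{\boldsymbol\mu},\mathbb E_{\boldsymbol\mu}$. Having a unique optimal arm means that there is an arm $a^*(\boldsymbol\mu)\in\mathcal A$ with $\mu_{a^*(\boldsymbol\mu)}>\max\{\mu_a: a\ne a^*(\boldsymbol\mu)\}$. A strategy consists of a sampling rule $(A_t)_t$ with $A_t$ being $\mathcal F_{t-1}$-measurable, a stopping rule $\tau_\delta$ which is a stopping time with respect to $(\mathcal F_t)$, and an $\mathcal F_{\tau_\delta}$-measurable decision $\hat a_{\tau_\delta}\in\mathcal A$. It is $\delta$-PAC (on $\mathcal S$) if for every $\boldsymbol\mu\in\mathcal S$, $\mathbb P_{\boldsymbol\mu}(\tau_\delta<\infty)=1$ and $\mathbb P_{\boldsymbol\mu}(\hat a_{\tau_\delta}\ne a^*(\boldsymbol\mu))\le\delta$. $\mathrm{Alt}(\boldsymbol\mu)=\{\boldsymbol\lambda\in\mathcal S: a^*(\boldsymbol\lambda)\neq a^*(\boldsymbol\mu)\}$ is the set of problems in $\mathcal S$ whose optimal arm differs from that of $\boldsymbol\mu$; $\Sigma_K=\{w\in\mathbb R_+^K: w_1+\dots+w_K=1\}$; $\mathrm{kl}(x,y)=x\log(x/y)+(1-x)\log((1-x)/(1-y))$.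
   Formalization: The bound is stated for δ in (0,1/2] instead of (0,1); for δ > 1/2 it is false, e.g. δ=0.9 with S={(.5,.4),(.4,.5)} Bernoulli and a one-sample strategy answering arm 1 iff X_1=1. *)

(* Defs.v *)
From HB Require Import structures.
From mathcomp Require Import all_boot all_order all_algebra.
From mathcomp Require Import all_classical all_reals all_analysis.
Set Implicit Arguments.
Unset Strict Implicit.
Unset Printing Implicit Defensive.
Import Order.TTheory GRing.Theory Num.Theory.
Import numFieldNormedType.Exports.
Local Open Scope classical_set_scope.
Local Open Scope ring_scope.

(** Derivatives relative to a set: the difference quotients only use points of
    [D], so that the values outside [D] of the total function [f] are
    irrelevant and end points of an interval are allowed. *)
Definition derivable_within (R : realType) (D : set R) (f : R -> R) (x : R) :=
  cvg ((f y - f x) / (y - x) @[y --> within D x^']).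

Definition derive_within (R : realType) (D : set R) (f : R -> R) (x : R) : R :=
  lim ((f y - f x) / (y - x) @[y --> within D x^']).

(** [ef_b] and [ef_nu] are total but only constrained on [ef_Theta].  Asking
    every parameter to be a limit point of [ef_Theta] is what makes the
    derivatives of [b : Theta -> R] meaningful (it holds for every
    nondegenerate interval).  [ef_density] at [A = setT] is the normalisation
    of the density. *)
Record exp_family (R : realType) := ExpFamily {
  ef_Theta : set R ;
  ef_xi : {measure set (measurableTypeR R) -> \bar R} ;
  ef_b : R -> R ;
  ef_nu : R -> probability (measurableTypeR R) R ;
  ef_limit_point : ef_Theta `<=` limit_point ef_Theta ;
  ef_convex : forall x y t, ef_Theta x -> ef_Theta y -> 0 <= t <= 1 ->
    ef_Theta (t * x + (1 - t) * y) ->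
    ef_b (t * x + (1 - t) * y) <= t * ef_b x + (1 - t) * ef_b y ;
  ef_derivable : forall theta, ef_Theta theta ->
    derivable_within ef_Theta ef_b theta ;
  ef_derivable2 : forall theta, ef_Theta theta ->
    derivable_within ef_Theta (derive_within ef_Theta ef_b) theta ;
  ef_density : forall theta, ef_Theta theta ->
    forall A : set (measurableTypeR R), measurable A ->
    ef_nu theta A =
      (\int[ef_xi]_(x in A) (expR (theta * x - ef_b theta))%:E)%E }.

Section ExpFamilyTheory.
Context {R : realType} (E : exp_family R).

Definition ef_bdot : R -> R := derive_within (ef_Theta E) (ef_b E).

(** The distribution [nu^mu] of the family with mean [mu]; meaningful for
    [mu] in the image of [ef_Theta] by [ef_bdot]. *)
Definition nu_of_mean (mu : R) : probability (measurableTypeR R) R :=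
  ef_nu E (xget 0 [set theta | ef_Theta E theta /\
                     (\int[ef_nu E theta]_x x%:E)%E = mu%:E]).

End ExpFamilyTheory.

Definition KL d (T : measurableType d) (R : realType) (P Q : probability T R) :
    \bar R :=
  if `[< P `<< Q >] then
    (\int[P]_x lne (Radon_Nikodym (charge_of_finite_measure P) Q x))%E
  else +oo%E.

Definition divergence (R : realType) (E : exp_family R) (mu mu' : R) : \bar R :=
  KL (nu_of_mean E mu) (nu_of_mean E mu').

Definition kl (R : realType) (x y : R) : R :=
  x * ln (x / y) + (1 - x) * ln ((1 - x) / (1 - y)).

(** A bandit model is identified with its vector of means; arm [a] of the
    model [mu] has law [nu_of_mean E (mu a)]. *)
Definition bandit_model (R : realType) (E : exp_family R) (K : nat)
    (mu : 'I_K -> R) :=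
  forall a, (ef_bdot E @` ef_Theta E) (mu a).

Section OptimalArm.
Context {R : realType} {K : nat}.
Implicit Types (mu lambda : 'I_K -> R) (S : set ('I_K -> R)).

Definition unique_optimal mu (a : 'I_K) :=
  [forall b : 'I_K, (b != a) ==> (mu b < mu a)].

(** [None] exactly when there is no unique optimal arm. *)
Definition astar mu : option 'I_K := [pick a | unique_optimal mu a].

Definition Alt S mu : set ('I_K -> R) :=
  [set lambda | S lambda /\ astar lambda <> astar mu].

Definition simplex : set ('I_K -> R) :=
  [set w | (forall a, 0 <= w a) /\ \sum_a w a = 1].

Local Open Scope ereal_scope.

Definition Tstar_inv (E : exp_family R) S mu : \bar R :=
  ereal_sup [set ereal_inf [set \sum_(a < K) (w a)%:E *
                                  divergence E (mu a) (lambda a)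
                            | lambda in Alt S mu]
            | w in simplex].

(** Extended inverse: [Tstar = +oo] if [Tstar_inv = 0], and [Tstar = 0] if
    [Tstar_inv = +oo] (which happens when [Alt S mu] is empty). *)
Definition Tstar (E : exp_family R) S mu : \bar R := (Tstar_inv E S mu)^-1.

End OptimalArm.

Section Strategy.
Context {d : measure_display} {Omega : measurableType d} {R : realType}.

(** [X t] is the reward at time [t >= 1] ([X 0] is not used);
    [history X t] is the sigma-algebra generated by [X 1, ..., X t]. *)
Definition history (X : nat -> {mfun Omega >-> measurableTypeR R}) (t : nat) :
    set (set Omega) :=
  <<s [set B | exists2 s, (1 <= s <= t)%N &
         preimage_set_system setT (X s) measurable B] >>.

(** [arm t] is the arm chosen at time [t >= 1] ([arm 0] is not used), and
    [tau = None] means that the strategy never stops.  The last two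
    fields say that the decision is measurable with respect to the
    sigma-algebra of the stopping time. *)
Record strategy (K : nat) (X : nat -> {mfun Omega >-> measurableTypeR R}) :=
  Strategy {
  arm : nat -> Omega -> 'I_K ;
  tau : Omega -> option nat ;
  decision : Omega -> 'I_K ;
  arm_predictable : forall t a, history X t (arm t.+1 @^-1` [set a]) ;
  tau_stopping : forall t : nat,
    history X t [set w | exists2 n, tau w = Some n & (n <= t)%N] ;
  decision_measurable : forall a, measurable (decision @^-1` [set a]) ;
  decision_stopped : forall a (t : nat),
    history X t ((decision @^-1` [set a]) `&`
                 [set w | exists2 n, tau w = Some n & (n <= t)%N]) }.

Context {K : nat} {X : nat -> {mfun Omega >-> measurableTypeR R}}.
Variable (st : strategy K X).

(** [P] is a law of the interaction of [st] with the model [mu]: on the event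
    that arm [a] is chosen at time [t.+1], the reward is drawn from
    [nu_of_mean E (mu a)] independently of the past. *)
Definition bandit_law (E : exp_family R) (mu : 'I_K -> R)
    (P : probability Omega R) :=
  forall (t : nat) (a : 'I_K) (F : set Omega) (B : set (measurableTypeR R)),
    history X t F -> measurable B ->
    P (F `&` (arm st t.+1 @^-1` [set a]) `&` (X t.+1 @^-1` B)) =
    (P (F `&` (arm st t.+1 @^-1` [set a])) * nu_of_mean E (mu a) B)%E.

Definition tau_ereal (w : Omega) : \bar R :=
  if tau st w is Some n then (n%:R)%:E else +oo%E.

(** [P mu] is the probability under the model [mu]. *)
Definition PAC (P : ('I_K -> R) -> probability Omega R) (S : set ('I_K -> R))
    (delta : R) :=
  forall mu, S mu ->
    P mu [set w | tau st w <> None] = 1%E /\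
    (P mu [set w | Some (decision st w) <> astar mu] <= delta%:E)%E.

End Strategy.

(* Main.v *)
Require Import Defs.
From HB Require Import structures.
From mathcomp Require Import all_boot all_order all_algebra.
From mathcomp Require Import all_classical all_reals all_analysis.
From mathcomp Require Import measurable_realfun ring lra.
Import Order.TTheory GRing.Theory Num.Theory.
Import numFieldNormedType.Exports.
Set Implicit Arguments.
Unset Strict Implicit.
Unset Printing Implicit Defensive.
Local Open Scope classical_set_scope.
Local Open Scope ring_scope.

(** The idea.  Let [mu] be the true model, [lambda] an alternative with another
    best arm, and [B] the event that the decision differs from the best arm of
    [mu].  The PAC property gives [P_mu(B) <= delta] and
    [P_lambda(B) >= 1 - delta]: what is observed up to the stopping time must
    tell the two models apart.  Quantitatively, if [n_a] is the expected number
    of draws of arm [a] before stopping, under [mu], then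
      [kl(delta, 1 - delta) <= \sum_a n_a d(mu_a, lambda_a)]
    ([kl_transport]).  The numbers [n_a] do not depend on [lambda] and sum to
    [E_mu(tau)] ([integral_tau]), so [w_a = n_a / E_mu(tau)] is a point of the
    simplex that competes in the supremum defining [1 / T*], and the
    inequality for all [lambda] at once is the theorem ([Tstar_mul_le]).

    The transport inequality is the Donsker-Varadhan variational formula,
    tested on a single function.  Let [L] be the likelihood ratio of
    [P_mu] to [P_lambda] up to the stopping time, and [f = c 1_B].  Integrating
    [1 + y <= exp y] at [y = f - ln L - ln m] under [P_mu] gives
      [c P_mu(B) + 1 - ln m <= E_mu(ln L) + E_mu(exp f / L) / m].
    On the right, [E_mu(ln L)] is [\sum_a n_a d(mu_a, lambda_a)] (Wald's
    identity, [integral_log_ratio]), and [E_mu(exp f / L)] is at most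
    [E_lambda(exp f)] (change of measure, [integral_stopped_ratio]).
    With [m = delta / (1 - delta)] and [c = 2 ln m], the values for which the
    formula is sharp when [P_mu(B) = delta] and [P_lambda(B) = 1 - delta], this
    is the bound by [kl(delta, 1 - delta)].

    To keep all sums finite, the argument is run with [min(tau, n)] in place of
    [tau] ([transport_finite_horizon]); [n] tends to infinity only in the
    numbers [P_lambda(B and tau <= n)].

    The change of measure comes by induction on time.  On an event
    [F and (X_(t+1) in C)] with [F] in the past, the next reward is independent
    of the past once the arm is fixed, so Fubini's theorem reduces the identity
    to the density of one arm law with respect to another
    ([reward_law_ge0_integral], [KL_log_density]); Dynkin's theorem extends it
    to the whole history ([history_succ_ind]). *)

(** * The Kullback-Leibler divergence as the mean of a log-density *)

Section LikelihoodRatio.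
Context d (T : measurableType d) (R : realType).
Implicit Types P Q : probability T R.
Local Open Scope ereal_scope.

Lemma ae_le_integral (mu : {measure set T -> \bar R}) (f g : T -> \bar R) :
  mu.-integrable setT f -> mu.-integrable setT g ->
  {ae mu, forall x, f x <= g x} -> \int[mu]_x f x <= \int[mu]_x g x.
Proof.
move=> fi gi [N [mN N0 sub]].
rewrite (negligible_integral mN measurableT fi N0).
rewrite (negligible_integral mN measurableT gi N0).
have mD : measurable (setT `\` N) by exact: measurableD.
apply: le_integral => //.
- exact: integrableS fi.
- exact: integrableS gi.
- by move=> x; rewrite inE => -[_ Nx]; apply: contrapT => fg; exact/Nx/sub.
Qed.

Lemma KL_dominates P Q : KL P Q < +oo -> P `<< Q.
Proof. by rewrite /KL; case: asboolP => //. Qed.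

(** A finite divergence is the mean of a genuine real function [g], the
    logarithm of the density [dP/dQ].  The set [G] where this density is
    positive carries [P], and there [exp (- g)] is the density [dQ/dP].  The
    negative part of [g] is dominated by [dQ/dP], whose integral is at most
    [1], so that a finite divergence makes the positive part integrable too. *)
Lemma KL_log_density P Q : KL P Q < +oo ->
  exists (g : T -> R) (G : set T),
  [/\ measurable G, P (~` G) = 0,
      P.-integrable setT (EFin \o g), \int[P]_x (g x)%:E = KL P Q &
      forall B, measurable B ->
        \int[P]_(x in B) (expR (- g x) * \1_G x)%:E = Q (B `&` G)].
Proof.
move=> KLoo; have PQ := KL_dominates KLoo.
move: (KLoo); rewrite /KL; case: asboolP => // _.
set rn := Radon_Nikodym _ _ => KLoo'.
have rnfin x : rn x \is a fin_num by exact: Radon_Nikodym_fin_num.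
have rni : Q.-integrable setT rn by exact: Radon_Nikodym_integrable.
pose r x := fine (rn x).
have rE x : rn x = (r x)%:E by rewrite fineK.
have mr : measurable_fun setT r.
  exact: (measurableT_comp (fine_measurable measurableT) (measurable_int _ rni)).
pose G := [set x | (0 < r x)%R].
have mG : measurable G.
  rewrite (_ : G = setT `&` r @^-1` `]0%R, +oo[).
    by apply: mr => //; exact: measurable_itv.
  by apply/seteqP; split => x; rewrite /G /= in_itv /= andbT; [split|case].
have PG : P (~` G) = 0.
  apply/eqP; rewrite eq_le measure_ge0 andbT.
  have -> : P (~` G) = \int[Q]_(x in ~` G) rn x.
    apply: (@Radon_Nikodym_integral _ _ _ (charge_of_finite_measure P)) => //.
    exact: measurableC.
  rewrite -leeN2 oppe0 -integralN; last first.
    apply: integrable_add_def; first exact: measurableC.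
    by apply: integrableS rni => //; exact: measurableC.
  apply: integral_ge0 => x /=; rewrite rE lee_fin oppr_ge0.
  by move/negP; rewrite -leNgt.
pose g x := ln (r x).
have mg : measurable_fun setT g by exact: measurableT_comp.
pose k x := (expR (- g x) * \1_G x)%R.
have mk : measurable_fun setT k.
  apply: measurable_funM; last exact: measurable_indic.
  by apply: measurableT_comp => //; exact: measurableT_comp.
have k0 x : (0 <= k x)%R by rewrite mulr_ge0 ?expR_ge0.
have change B : measurable B -> \int[P]_(x in B) (k x)%:E = Q (B `&` G).
  move=> mB.
  have mkB : measurable_fun B (EFin \o k).
    by apply/measurable_EFinP; exact: measurable_funTS.
  rewrite -(Radon_Nikodym_SigmaFinite.change_of_variables PQ) //=.
  have -> : Q (B `&` G) = \int[Q]_(x in B) (\1_G x)%:E.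
    by rewrite integral_indic // setIC.
  apply: ae_eq_integral => //.
  - apply: emeasurable_funM => //; apply: measurable_funTS.
    exact: measurable_int (Radon_Nikodym_SigmaFinite.f_integrable PQ).
  - by apply/measurable_EFinP; exact: measurable_indic.
  have := ae_eq_Radon_Nikodym_SigmaFinite PQ mB.
  apply: filterS => x /[apply] ->; rewrite -/rn rE -EFinM; congr EFin.
  rewrite /k indicE; case: (boolP (x \in G)) => [/set_mem|_]; rewrite ?mulr0 ?mul0r//.
  by rewrite /G /= => r0; rewrite mulr1 expRN lnK// mulVf// gt_eqF.
have KLE : \int[P]_x lne (rn x) = \int[P]_x (g x)%:E.
  apply: ae_eq_integral => //.
  - rewrite (_ : (fun x => _) = fun x => if (r x <= 0)%R then -oo else (g x)%:E).
      apply: measurable_fun_ifT => //; last exact/measurable_EFinP.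
      exact: measurable_fun_ler.
    by apply/funext => x; rewrite rE.
  - exact/measurable_EFinP.
  exists (~` G); split => //; first exact: measurableC.
  move=> x /= h Gx; apply: h => _; rewrite rE lne_EFin//.
have gN : \int[P]_x (EFin \o g)^\- x <= 1.
  apply: (@le_trans _ _ (\int[P]_x (k x)%:E)).
    apply: ge0_le_integral => //.
    - exact/measurable_funeneg/measurable_EFinP.
    - exact/measurable_EFinP.
    move=> x _ /=; rewrite funenegE /= -EFin_max lee_fin ge_max k0 andbT.
    rewrite /k indicE; case: (boolP (x \in G)) => [_|/negP].
      by rewrite mulr1; have := expR_ge1Dx (- g x); lra.
    by rewrite inE /G /= => /negP; rewrite -leNgt => r0; rewrite /g ln0// oppr0 mulr0.
  by rewrite change// setTI probability_le1.
have gi : P.-integrable setT (EFin \o g).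
  apply/integrableP; split; first exact/measurable_EFinP.
  under eq_integral do rewrite -/((abse \o (EFin \o g)) _) fune_abse.
  rewrite ge0_integralD//; last 2 first.
    exact/measurable_funepos/measurable_EFinP.
    exact/measurable_funeneg/measurable_EFinP.
  have gNoo : \int[P]_x (EFin \o g)^\- x < +oo by exact: le_lt_trans gN (ltry _).
  apply: lte_add_pinfty => //.
  move: KLoo'; rewrite KLE [X in X < _ -> _]integralE -/(EFin \o g).
  have : \int[P]_x (EFin \o g)^\- x \is a fin_num.
    by rewrite ge0_fin_numE//; exact: integral_ge0.
  case: (\int[P]_x (EFin \o g)^\- x) => //= a _.
  by case: (\int[P]_x (EFin \o g)^\+ x) => [b _|//|_]; rewrite ?ltry.
by exists g, G; split => //; rewrite KLE.
Qed.

(** Integrate [1 - g <= exp (- g)], where [exp (- g)] has integral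
    [Q G <= 1]. *)
Lemma KL_ge0 P Q : 0 <= KL P Q.
Proof.
have [KLoo|] := ltP (KL P Q) +oo; last by rewrite leye_eq => /eqP ->.
have [g [G [mG PG gi <- change]]] := KL_log_density KLoo.
have mg : measurable_fun setT g by exact/measurable_EFinP/measurable_int/gi.
pose k x := (expR (- g x) * \1_G x)%R.
have mk : measurable_fun setT k.
  apply: measurable_funM; last exact: measurable_indic.
  by apply: measurableT_comp => //; exact: measurableT_comp.
have ki : P.-integrable setT (EFin \o k).
  apply/integrableP; split; first exact/measurable_EFinP.
  under eq_integral do rewrite /= ger0_norm ?mulr_ge0 ?expR_ge0//.
  by rewrite change// (le_lt_trans (probability_le1 _ _)) ?ltry//; exact: measurableI.
have ci : P.-integrable setT (EFin \o cst 1%R).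
  exact: finite_measure_integrable_cst.
have : \int[P]_x (1 : R)%:E <= \int[P]_x ((g x)%:E + (k x)%:E).
  apply: ae_le_integral => //; first exact: integrableD.
  exists (~` G); split => //; first exact: measurableC.
  move=> x /= h Gx; apply: h; rewrite -EFinD lee_fin /k indicE mem_set// mulr1.
  by have := expR_ge1Dx (- g x); lra.
have -> : \int[P]_x (1 : R)%:E = 1.
  by rewrite (integral_cst P measurableT 1) mul1e; exact: probability_setT.
rewrite integralD// change// setTI => h.
have : \int[P]_x (g x)%:E \is a fin_num by exact: integrable_fin_num.
move: h (probability_le1 Q mG); case: (\int[P]_x (g x)%:E) => // a.
have : Q G \is a fin_num by exact: fin_num_measure.
case: (Q G) => // b _; rewrite -EFinD !lee_fin => h1 h2 _; lra.
Qed.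

End LikelihoodRatio.

(** * Integration of independent variables *)

Section RestrictedIntegral.
Context d (Omega : measurableType d) (R : realType).
Variables (P : probability Omega R) (A : set Omega).
Hypothesis mA : measurable A.
Local Open Scope ereal_scope.

Lemma ge0_integral_mrestr (f : Omega -> \bar R) :
  measurable_fun setT f -> (forall x, 0 <= f x) ->
  \int[mrestr P mA]_x f x = \int[P]_(x in A) f x.
Proof.
move=> mf f0; rewrite -(setUv A) ge0_integral_setU//=; last 3 first.
- exact: measurableC.
- by rewrite setUv.
- by rewrite /disj_set setICr.
rewrite [X in _ + X](_ : _ = 0) ?adde0; last first.
  apply: null_set_integral => //; first exact: measurableC.
  - exact: measurable_funTS.
  - by rewrite /= /mrestr setICl measure0.
by apply: eq_measure_integral => B mB BA; rewrite /= /mrestr setIidl.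
Qed.

End RestrictedIntegral.

(** The arguments [mA] and [mphi] appear so that the structure of finite
    measure can be inferred from the term itself. *)
Definition restricted_law d d1 (Omega : measurableType d)
    (T1 : measurableType d1) (R : realType) (P : probability Omega R)
    (A : set Omega) (mA : measurable A) (phi : Omega -> T1)
    (mphi : measurable_fun setT phi) : set T1 -> \bar R :=
  pushforward (mrestr P mA) phi.

Section RestrictedLaw.
Context d d1 (Omega : measurableType d) (T1 : measurableType d1) (R : realType).
Variables (P : probability Omega R) (A : set Omega) (mA : measurable A).
Variables (phi : Omega -> T1) (mphi : measurable_fun setT phi).
Local Open Scope ereal_scope.
Local Notation law := (restricted_law P mA mphi).

Let law_measure : {measure set T1 -> \bar R}.
Proof.
by unshelve refine (pushforward (mrestr P mA) phi : {measure set T1 -> \bar R}).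
Defined.

HB.instance Definition _ := Measure.copy law law_measure.

Let law_fin : fin_num_fun law.
Proof.
move=> B mB; rewrite /restricted_law /pushforward /mrestr fin_num_measure//.
by apply: measurableI => //; rewrite -[X in measurable X]setTI; exact: mphi.
Qed.

HB.instance Definition _ := Measure_isFinite.Build _ _ _ law law_fin.

Lemma restricted_lawE B : law B = P (A `&` phi @^-1` B).
Proof. by rewrite /restricted_law /pushforward /mrestr setIC. Qed.

Lemma ge0_integral_restricted_law (f : T1 -> \bar R) :
  measurable_fun setT f -> (forall x, 0 <= f x) ->
  \int[law]_x f x = \int[P]_(w in A) f (phi w).
Proof.
move=> mf f0; rewrite ge0_integral_pushforward// preimage_setT.
by apply: ge0_integral_mrestr => [|w]; [exact: (measurableT_comp mf mphi)|exact: f0].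
Qed.

End RestrictedLaw.

Section IndependentIntegral.
Context d d1 d2 (Omega : measurableType d) (T1 : measurableType d1)
  (T2 : measurableType d2) (R : realType).
Variables (P : probability Omega R) (nu : probability T2 R) (A : set Omega).
Variables (phi : Omega -> T1) (X : Omega -> T2).
Hypotheses (mA : measurable A) (mphi : measurable_fun setT phi).
Hypotheses (mX : measurable_fun setT X).
Local Open Scope ereal_scope.
Hypothesis indep : forall B1 B2, measurable B1 -> measurable B2 ->
  P (A `&` phi @^-1` B1 `&` X @^-1` B2) = P (A `&` phi @^-1` B1) * nu B2.

(** On [A], the pair [(phi, X)] has a product law, because it agrees with it on
    rectangles; Fubini-Tonelli then separates the variables. *)
Lemma ge0_integral_indep (Y : T1 -> \bar R) (k : T2 -> \bar R) :
  measurable_fun setT Y -> (forall x, 0 <= Y x) ->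
  measurable_fun setT k -> (forall x, 0 <= k x) ->
  \int[P]_(w in A) (Y (phi w) * k (X w)) =
  (\int[P]_(w in A) Y (phi w)) * \int[nu]_x k x.
Proof.
move=> mY Y0 mk k0.
have mphiX : measurable_fun setT (fun w => (phi w, X w)).
  exact: measurable_fun_pair.
pose f (z : T1 * T2) := Y z.1 * k z.2.
have mf : measurable_fun setT f.
  apply: emeasurable_funM; first exact: (measurableT_comp mY).
  exact: (measurableT_comp mk).
have f0 z : 0 <= f z by rewrite mule_ge0.
rewrite -(ge0_integral_restricted_law P mA mphiX mf f0).
pose m1 := restricted_law P mA mphi.
rewrite (@eq_measure_integral _ _ _ _ (m1 \x nu)%E); last first.
  move=> B mB _; apply/esym; apply: product_measure_unique => // B1 B2 mB1 mB2.
  by rewrite /= !restricted_lawE -indep// -setIA.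
rewrite fubini_tonelli1// /fubini_F.
under eq_integral do rewrite /f /= ge0_integralZl//.
rewrite ge0_integralZr//; last exact: integral_ge0.
by rewrite ge0_integral_restricted_law.
Qed.

End IndependentIntegral.

(** * Finite partitions *)

Section FinitePartition.
Context d (Omega : measurableType d) (R : realType) (m : nat).
Variable c : Omega -> 'I_m.
Hypothesis mc : forall i, measurable (c @^-1` [set i]).
Local Open Scope ereal_scope.

Lemma measurable_fun_select d' (T : measurableType d') (h : 'I_m -> Omega -> T) :
  (forall i, measurable_fun setT (h i)) ->
  measurable_fun setT (fun w => h (c w) w).
Proof.
move=> mh _ B mB; rewrite setTI.
have -> : (fun w => h (c w) w) @^-1` B =
    \bigcup_(i in [set: 'I_m]) (c @^-1` [set i] `&` h i @^-1` B).
  apply/seteqP; split=> [w Bw|w [i _ [/= <-]]//]; by exists (c w).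
apply: fin_bigcup_measurable => // i _; apply: measurableI => //.
by rewrite -[X in measurable X]setTI; exact: mh.
Qed.

Lemma ge0_integral_partition (mu : {measure set Omega -> \bar R})
    (S : set Omega) (f : Omega -> \bar R) :
  measurable S -> measurable_fun setT f -> (forall w, 0 <= f w) ->
  \int[mu]_(w in S) f w = \sum_(i < m) \int[mu]_(w in S `&` c @^-1` [set i]) f w.
Proof.
move=> mS mf f0.
have SE : S = \big[setU/set0]_(i <- index_enum 'I_m) (S `&` c @^-1` [set i]).
  rewrite -bigcup_seq; apply/seteqP; split=> [w Sw|w [i _ []]//].
  by exists (c w); rewrite /= ?mem_index_enum.
rewrite [in LHS]SE ge0_integral_bigsetU//=.
- by move=> i; exact: measurableI.
- exact: index_enum_uniq.
- by move=> i j _ _ [w [[_ /= <-] [_ /= <-]]].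
- exact: measurable_funTS.
Qed.

Lemma measure_partition (mu : {measure set Omega -> \bar R}) (S : set Omega) :
  measurable S -> mu S = \sum_(i < m) mu (S `&` c @^-1` [set i]).
Proof.
move=> mS; have := @ge0_integral_partition mu S (cst 1) mS.
rewrite integral_cst// mul1e => -> //.
by apply: eq_bigr => i _; rewrite integral_cst ?mul1e//; exact: measurableI.
Qed.

End FinitePartition.

(** * Histories *)

Section History.
Context d (Omega : measurableType d) (R : realType).
Variable X : nat -> {mfun Omega >-> measurableTypeR R}.

Definition history_gen (t : nat) : set (set Omega) :=
  [set B | exists2 s, (1 <= s <= t)%N &
     preimage_set_system setT (X s) measurable B].

(** The past as a measurable type on the same points, so that [F_t]-measurable
    functions are measurable functions on [past t]. *)
Definition past (t : nat) := g_sigma_algebraType (history_gen t).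

Lemma history_measurable t F : history X t F -> measurable F.
Proof.
apply: smallest_sub; first exact: sigma_algebra_measurable.
by move=> _ [s _ [B mB <-]]; exact: measurable_funP.
Qed.

Lemma history_mono s t F : (s <= t)%N -> history X s F -> history X t F.
Proof.
move=> st; apply: sub_sigma_algebra2 => A [r /andP[r1 rs] rA].
by exists r => //; rewrite r1 (leq_trans rs st).
Qed.

Lemma historyT t : history X t setT.
Proof. exact: (@measurableT _ (past t)). Qed.

Lemma historyC t F : history X t F -> history X t (~` F).
Proof. exact: (@measurableC _ (past t)). Qed.

Lemma historyI t F G : history X t F -> history X t G -> history X t (F `&` G).
Proof. exact: (@measurableI _ (past t)). Qed.

Lemma measurable_past t : measurable_fun setT (fun w : Omega => w : past t).
Proof. by move=> _ B mB; rewrite setTI; exact: history_measurable mB. Qed.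

Lemma measurable_reward_past t :
  measurable_fun setT (X t.+1 : past t.+1 -> measurableTypeR R).
Proof.
move=> _ B mB; apply: sub_sigma_algebra.
by exists t.+1; [rewrite /= leqnn|exists B].
Qed.

(** Nothing is observed before time [1]. *)
Lemma history0 F : history X 0 F -> F = set0 \/ F = setT.
Proof.
have sg : sigma_algebra setT [set F : set Omega | F = set0 \/ F = setT].
  split=> [|A|A AE]; first by left.
    by case=> ->; [right; rewrite setD0|left; rewrite setDv].
  have [[i Ai]|nA] := pselect (exists i, A i = setT).
    by right; apply/seteqP; split=> // w _; exists i; rewrite ?Ai.
  left; apply/seteqP; split=> // w [i _]; have [->//|Ai] := AE i.
  by case: nA; exists i.
by apply: (smallest_sub sg) => A [s]; case: s.
Qed.

(** The rectangles [F and (X_(t+1) in B)] are stable under intersection and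
    generate the history at time [t+1], so Dynkin's theorem applies. *)
Lemma history_succ_ind t (C : set (set Omega)) : dynkin C ->
  (forall F B, history X t F -> measurable B -> C (F `&` X t.+1 @^-1` B)) ->
  forall F, history X t.+1 F -> C F.
Proof.
move=> dC rect.
pose Rect : set (set Omega) :=
  [set A | exists F B, [/\ history X t F, measurable B & A = F `&` X t.+1 @^-1` B]].
have RI : setI_closed Rect.
  move=> _ _ [F [B [hF mB ->]]] [F' [B' [hF' mB' ->]]].
  exists (F `&` F'), (B `&` B'); split; first exact: historyI.
    exact: measurableI.
  by rewrite preimage_setI setIACA.
have sub : history X t.+1 `<=` <<s Rect >>.
  apply: sub_sigma_algebra2 => A [s /andP[s1 st1] [B mB <-]].
  move: st1; rewrite leq_eqVlt => /orP[/eqP st|].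
    exists setT, B; split => //; first exact: historyT.
    by rewrite st.
  rewrite ltnS => st; exists (setT `&` X s @^-1` B), setT; split => //.
    by apply: sub_sigma_algebra; exists s; [rewrite s1|exists B].
  by rewrite preimage_setT setIT.
move=> F /sub; rewrite -setI_closed_g_dynkin_g_sigma_algebra//.
by apply: smallest_sub => // _ [F' [B [hF mB ->]]]; exact: rect.
Qed.

End History.

(** * Rewards given the past *)

Section Interaction.
Context d (Omega : measurableType d) (R : realType) (K : nat).
Variable X : nat -> {mfun Omega >-> measurableTypeR R}.
Variable st : strategy K X.
Implicit Types (p q : 'I_K -> probability (measurableTypeR R) R).
Implicit Types (P Q : probability Omega R) (n t : nat) (w : Omega).
Local Open Scope ereal_scope.

(** [bandit_law] with arbitrary arm laws [p] in place of those attached to a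
    vector of means. *)
Definition reward_law p P :=
  forall t a F (B : set (measurableTypeR R)), history X t F -> measurable B ->
    P (F `&` (arm st t.+1 @^-1` [set a]) `&` (X t.+1 @^-1` B)) =
    P (F `&` (arm st t.+1 @^-1` [set a])) * p a B.

Definition stopped_by t : set Omega :=
  [set w | exists2 n, tau st w = Some n & (n <= t)%N].

Definition drawn_running t a : set Omega :=
  ~` stopped_by t `&` arm st t.+1 @^-1` [set a].

Lemma history_running t : history X t (~` stopped_by t).
Proof. exact: (historyC (tau_stopping st (t:=t))). Qed.

Lemma measurable_stopped_by t : measurable (stopped_by t).
Proof. exact: history_measurable (tau_stopping st (t:=t)). Qed.

Lemma measurable_arm t a : measurable (arm st t.+1 @^-1` [set a]).
Proof. exact: history_measurable (arm_predictable st a). Qed.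

Lemma measurable_drawn_running t a : measurable (drawn_running t a).
Proof.
apply: measurableI; last exact: measurable_arm.
exact/measurableC/measurable_stopped_by.
Qed.

Lemma measurable_arm_reward (h : 'I_K -> measurableTypeR R -> R) t :
  (forall a, measurable_fun setT (h a)) ->
  measurable_fun setT (fun w : past X t.+1 => h (arm st t.+1 w) (X t.+1 w)).
Proof.
move=> mh.
apply: (@measurable_fun_select _ (past X t.+1) K (arm st t.+1) _ _ _
  (fun a w => h a (X t.+1 w))) => a.
  exact: (history_mono (leqnSn t) (arm_predictable st a)).
exact: (measurableT_comp (mh a) (@measurable_reward_past _ _ _ X t)).
Qed.

(** The defining product rule of [reward_law], extended from events to
    functions of the past and of the next reward. *)
Lemma reward_law_ge0_integral p P t a F (Y : past X t -> \bar R)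
    (k : measurableTypeR R -> \bar R) :
  reward_law p P -> history X t F ->
  measurable_fun setT Y -> (forall w, 0 <= Y w) ->
  measurable_fun setT k -> (forall x, 0 <= k x) ->
  \int[P]_(w in F `&` arm st t.+1 @^-1` [set a]) (Y w * k (X t.+1 w)) =
  \int[P]_(w in F `&` arm st t.+1 @^-1` [set a]) Y w * \int[p a]_x k x.
Proof.
move=> lawP hF mY Y0 mk k0.
have hFa := historyI hF (arm_predictable st a).
apply: (@ge0_integral_indep _ _ _ Omega (past X t) (measurableTypeR R) R P (p a)
  _ (fun w => w) (X t.+1)) => //.
- exact: history_measurable hFa.
- exact: measurable_past.
move=> B1 B2 hB1 mB2; rewrite -[X in _ `&` X `&` _]/B1 -[X in P (_ `&` X) * _]/B1.
by rewrite (setIAC F) lawP//; exact: (historyI hF hB1).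
Qed.

(** The step of Wald's identity: [reward_law_ge0_integral] with [Y = 1],
    applied to the positive and to the negative part of [g]. *)
Lemma reward_law_integral p P t a F (g : measurableTypeR R -> R) :
  reward_law p P -> history X t F -> (p a).-integrable setT (EFin \o g) ->
  let D := F `&` arm st t.+1 @^-1` [set a] in
  P.-integrable D (EFin \o (g \o X t.+1)) /\
  \int[P]_(w in D) (g (X t.+1 w))%:E = P D * \int[p a]_x (g x)%:E.
Proof.
move=> lawP hF gi D.
have mD : measurable D.
  exact: (history_measurable (historyI hF (arm_predictable st a))).
have /measurable_EFinP mg := measurable_int _ gi.
have drawE (k : measurableTypeR R -> \bar R) : measurable_fun setT k -> (forall x, 0 <= k x) ->
    \int[P]_(w in D) k (X t.+1 w) = P D * \int[p a]_x k x.
  move=> mk k0.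
  have := @reward_law_ge0_integral p P t a F (cst 1) k lawP hF _ _ mk k0.
  rewrite integral_cst// mul1e => <- //.
  by apply: eq_integral => w _; rewrite mul1e.
have mgX : measurable_fun D (EFin \o (g \o X t.+1)).
  by apply/measurable_EFinP/measurable_funTS; exact: measurableT_comp.
split.
  apply/integrableP; split => //.
  rewrite (drawE (fun x => `|(g x)%:E|))//; last first.
    by apply: measurableT_comp => //; exact/measurable_EFinP.
  have /integrableP[_ goo] := gi.
  rewrite -ge0_fin_numE; last by rewrite mule_ge0// integral_ge0.
  by rewrite fin_numM// ?fin_num_measure// ge0_fin_numE ?integral_ge0.
rewrite integralE [in RHS]integralE muleBr; last 2 first.
- by rewrite fin_num_measure.
- exact: (integrable_add_def measurableT gi).
congr (_ - _).
  rewrite -(drawE (EFin \o g)^\+) //; last exact/measurable_funepos/measurable_EFinP.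
  by apply: eq_integral => w _; rewrite !funeposE.
rewrite -(drawE (EFin \o g)^\-) //; last exact/measurable_funeneg/measurable_EFinP.
by apply: eq_integral => w _; rewrite !funenegE.
Qed.

End Interaction.

(** * The likelihood ratio process *)

Section LikelihoodProcess.
Context d (Omega : measurableType d) (R : realType) (K : nat).
Variable X : nat -> {mfun Omega >-> measurableTypeR R}.
Variable st : strategy K X.
Variables (g : 'I_K -> measurableTypeR R -> R).
Variables (G : 'I_K -> set (measurableTypeR R)).
Hypothesis mg : forall a, measurable_fun setT (g a).
Hypothesis mG : forall a, measurable (G a).
Implicit Types (n t : nat) (w : Omega).
Local Open Scope ereal_scope.

(** The density of the law of a reward under the second model with respect to
    the first one, cut off to the set where they are equivalent. *)
Definition step_ratio a (x : measurableTypeR R) : R :=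
  (expR (- g a x) * \1_(G a) x)%R.

(** The inverse likelihood ratio [dQ/dP] of the first [t] observations. *)
Fixpoint inv_ratio t w : R :=
  if t is s.+1 then
    (inv_ratio s w * step_ratio (arm st s.+1 w) (X s.+1 w))%R
  else 1%R.

(** The event that the first [t] rewards avoid the singular parts; off it
    [inv_ratio t] vanishes. *)
Fixpoint regular t : set Omega :=
  if t is s.+1 then
    regular s `&` [set w | G (arm st s.+1 w) (X s.+1 w)]
  else setT.

Lemma step_ratio_ge0 a x : (0 <= step_ratio a x)%R.
Proof. by rewrite mulr_ge0 ?expR_ge0. Qed.

Lemma inv_ratio_ge0 t w : (0 <= inv_ratio t w)%R.
Proof. by elim: t => //= t IH; rewrite mulr_ge0 ?step_ratio_ge0. Qed.

Lemma measurable_step_ratio a : measurable_fun setT (step_ratio a).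
Proof.
apply: measurable_funM; last exact: measurable_indic.
by apply: measurableT_comp => //; exact: measurableT_comp.
Qed.

Lemma measurable_past_mono s t (h : past X s -> R) : (s <= t)%N ->
  measurable_fun setT h -> measurable_fun setT (h : past X t -> R).
Proof.
by move=> st' mh mD B mB; exact: (history_mono st' (mh measurableT B mB)).
Qed.

(** [inv_ratio t] depends on the past only, which the induction in
    [integral_inv_ratio] needs in order to use independence. *)
Lemma measurable_inv_ratio_past t :
  measurable_fun setT (inv_ratio t : past X t -> R).
Proof.
elim: t => [|t IH] /=; first exact: measurable_cst.
apply: measurable_funM; first exact: (measurable_past_mono (leqnSn t)).
by apply: measurable_arm_reward => a; exact: measurable_step_ratio.
Qed.

Lemma measurable_inv_ratio t : measurable_fun setT (inv_ratio t).
Proof.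
move=> mD B mB.
apply: (@history_measurable _ _ _ X t).
exact: (measurable_inv_ratio_past measurableT mB).
Qed.

(** The set is the preimage of [1] by the indicator of [G] at the drawn arm
    and reward. *)
Lemma history_regular_step t :
  history X t.+1 [set w | G (arm st t.+1 w) (X t.+1 w)].
Proof.
pose h a x : R := \1_(G a) x.
have mh a : measurable_fun setT (h a) by exact: measurable_indic.
have := measurable_arm_reward st (t := t) mh measurableT (measurable_set1 1%R).
rewrite setTI (_ : _ @^-1` _ = [set w | G (arm st t.+1 w) (X t.+1 w)])//.
apply/seteqP; split=> w /=; rewrite /h indicE.
  by case: (boolP (_ \in _)) => [/set_mem//|_ /esym/eqP]; rewrite oner_eq0.
by move=> Gw; rewrite mem_set.
Qed.

Lemma history_regular t : history X t (regular t).
Proof.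
elim: t => [|t IH] /=; first exact: historyT.
by apply: historyI; [exact: history_mono IH|exact: history_regular_step].
Qed.

Lemma regularP t w : regular t w <->
  forall s, (s < t)%N -> G (arm st s.+1 w) (X s.+1 w).
Proof.
elim: t => [|t IH]; first by split.
split=> [[/IH reg Gt] s|reg].
  by rewrite ltnS leq_eqVlt => /orP[/eqP ->|/reg].
by split; [apply/IH => s st'; exact/reg/ltnW|exact: reg].
Qed.

Lemma inv_ratioE t w : regular t w ->
  inv_ratio t w = expR (- \sum_(s < t) g (arm st s.+1 w) (X s.+1 w)).
Proof.
elim: t => [|t IH] /=; first by rewrite big_ord0 oppr0 expR0.
move=> [/IH -> Gw]; rewrite big_ord_recr /= opprD expRD /step_ratio.
by rewrite indicE mem_set// mulr1.
Qed.

Variables (p q : 'I_K -> probability (measurableTypeR R) R).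
Variables (P Q : probability Omega R).
Hypotheses (lawP : reward_law st p P) (lawQ : reward_law st q Q).
Hypothesis ratioE : forall a (B : set (measurableTypeR R)), measurable B ->
  \int[p a]_(x in B) (step_ratio a x)%:E = q a (B `&` G a).

(** The change of measure.  It is an equality, rather than the inequality used
    later, because equality is what survives complements in Dynkin's theorem;
    this is why the event [regular t] is carried along. *)
Lemma integral_inv_ratio t F : history X t F ->
  \int[P]_(w in F) (inv_ratio t w)%:E = Q (F `&` regular t).
Proof.
elim: t F => [|t IH] F hF.
  rewrite /= setIT integral_cst ?mul1e; last exact: history_measurable hF.
  have [->|->] := history0 hF; first by rewrite !measure0.
  exact: (etrans (probability_setT P) (esym (probability_setT Q))).
have mreg s : measurable (regular s) by exact: (history_measurable (@history_regular s)).
have mir s : measurable_fun setT (EFin \o inv_ratio s).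
  exact/measurable_EFinP/measurable_inv_ratio.
have ir0 s w : 0 <= (inv_ratio s w)%:E by rewrite lee_fin inv_ratio_ge0.
pose C : set (set Omega) := [set F | measurable F /\
  \int[P]_(w in F) (inv_ratio t.+1 w)%:E = Q (F `&` regular t.+1)].
suff : C F by case.
have rect F' B : history X t F' -> measurable B -> C (F' `&` X t.+1 @^-1` B).
  move=> hF' mB.
  have mF' := history_measurable hF'.
  have mXB : measurable (X t.+1 @^-1` B) by exact: measurable_funPTI.
  have mS : measurable (F' `&` X t.+1 @^-1` B) by exact: measurableI.
  split => //.
  have marm a := measurable_arm st t a.
  (* Split according to the arm drawn at time [t+1]. *)
  rewrite (ge0_integral_partition marm _ mS (mir _) (ir0 _)).
  rewrite (measure_partition marm Q (measurableI _ _ mS (mreg _))).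
  apply: eq_bigr => a _.
  have hFa := historyI hF' (arm_predictable st a).
  pose k x := ((step_ratio a) \_ B) x.
  transitivity (\int[P]_(w in F' `&` arm st t.+1 @^-1` [set a])
     ((inv_ratio t w)%:E * (k (X t.+1 w))%:E)).
    rewrite setIAC integral_mkcondr; apply: eq_integral => w.
    rewrite inE => -[_ /= wa]; rewrite /k /patch.
    have -> : (w \in X t.+1 @^-1` B) = (X t.+1 w \in B) by [].
    rewrite /= wa.
    by case: ifPn => _; rewrite ?mule0// EFinM.
  rewrite (@reward_law_ge0_integral _ _ _ _ _ _ p P t a F'
     (EFin \o inv_ratio t) (EFin \o k))//; last 4 first.
  - by apply/measurable_EFinP; exact: measurable_inv_ratio_past.
  - exact: ir0.
  - apply/measurable_EFinP/(measurable_restrictT _ mB).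
    by apply: measurable_funTS; exact: measurable_step_ratio.
  - by move=> x; rewrite lee_fin /k /patch; case: ifPn => // _; exact: step_ratio_ge0.
  rewrite IH//.
  have -> : \int[p a]_x (EFin \o k) x = q a (B `&` G a).
    rewrite -ratioE// [RHS]integral_mkcond; apply: eq_integral => x _.
    by rewrite /k /patch /=; case: ifPn.
  rewrite setIAC -lawQ//; [|exact: (historyI hF' (@history_regular t))
                           |exact: measurableI].
  congr (Q _); apply/seteqP; split=> w /=.
    by move=> [[[? ?] wa] [? ?]]; rewrite /= -wa; do !split => //; rewrite wa.
  by move=> [[[? ?] [? +]] wa]; rewrite wa.
apply: (history_succ_ind _ rect hF); split.
- have [_] := rect setT setT (@historyT _ _ _ X t) measurableT.
  by rewrite preimage_setT setIT.
- move=> A [mA AE]; split; first exact: measurableC.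
  have [_] := rect setT setT (@historyT _ _ _ X t) measurableT.
  rewrite preimage_setT setIT -(setUv A).
  rewrite ge0_integral_setU//; last 3 first.
  + exact: measurableC.
  + exact: (measurable_funTS (mir t.+1)).
  + by rewrite /disj_set setICr.
  rewrite AE setIUl measureU; last 3 first.
  + exact: measurableI.
  + by apply: measurableI => //; exact: measurableC.
  + by rewrite setIACA setICr set0I.
  set u := Q (A `&` _).
  have ufin : u \is a fin_num.
    by rewrite fin_num_measure//; apply: measurableI => //; exact: (mreg t.+1).
  by move=> /(congr1 (fun z => z - u)); rewrite !(addeC u) !addeK.
- move=> A tA CA; have mA i : measurable (A i) by case: (CA i).
  split; first exact: bigcupT_measurable.
  rewrite ge0_integral_bigcup//; last exact: (measurable_funTS (mir t.+1)).
  rewrite setI_bigcupl measure_semi_bigcup//.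
  + by apply: eq_eseriesr => i _; case: (CA i).
  + by move=> i; exact: measurableI.
  + exact: trivIset_setIr.
  + by apply: bigcupT_measurable => i; exact: measurableI.
Qed.

(** * Stopping *)

(** [min (tau, n)], with values in an ordinal so that one can sum over them. *)
Definition trunc_tau n w : 'I_n.+1 :=
  inord (if tau st w is Some k then minn k n else n).

Lemma lt_trunc_tau n w s : (s < trunc_tau n w)%N <->
  (s < n)%N /\ ~ stopped_by st s w.
Proof.
rewrite /trunc_tau inordK; last by case: tau => // k; rewrite ltnS geq_minr.
rewrite /stopped_by /=; case: tau => [k|]; last first.
  by split=> [sn|[]//]; split=> // -[].
rewrite leq_min; split=> [/andP[sk sn]|[sn ns]].
  by split=> // -[_ [<-] ks]; move: sk; rewrite ltnNge ks.
by rewrite sn andbT ltnNge; apply/negP => ks; apply: ns; exists k.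
Qed.

Lemma trunc_tau_stopped n w :
  stopped_by st n w <-> stopped_by st (trunc_tau n w) w.
Proof.
rewrite /trunc_tau inordK; last by case: tau => // k; rewrite ltnS geq_minr.
rewrite /stopped_by /=; case: tau => [k|]; last by split=> -[].
split=> -[_ [<-] kn]; exists k => //; first by rewrite leq_min leqnn.
by rewrite (leq_trans kn)// geq_minr.
Qed.

(** [min (tau, n)] is a stopping time: it equals [t] when the strategy has not
    stopped before [t] and, if [t < n], has stopped at [t]. *)
Lemma history_trunc_tau n (t : 'I_n.+1) :
  history X t (trunc_tau n @^-1` [set t]).
Proof.
pose before : set Omega := if (t : nat) is s.+1 then ~` stopped_by st s else setT.
pose at_t : set Omega := if (t < n)%N then stopped_by st t else setT.
rewrite (_ : _ @^-1` _ = before `&` at_t).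
  apply: historyI.
    rewrite /before; case: (t : nat) => [|s]; first exact: historyT.
    by apply: history_mono (leqnSn s) _; exact: history_running.
  rewrite /at_t; case: ifPn => _; last exact: historyT.
  exact: (tau_stopping st (t := t)).
apply/seteqP; split=> w /=.
  move=> tE; split.
    rewrite /before -tE; case E : (trunc_tau n w : nat) => [|s]//.
    by have [] : (s < n)%N /\ ~ stopped_by st s w by apply/lt_trunc_tau; rewrite E.
  rewrite /at_t -tE; case: ifPn => // tn; apply: contrapT => ns.
  have : (trunc_tau n w < trunc_tau n w)%N by apply/lt_trunc_tau.
  by rewrite ltnn.
move=> [wb wa]; apply/val_inj/eqP => /=; rewrite eqn_leq; apply/andP; split.
  rewrite leqNgt; apply/negP => /lt_trunc_tau[tn]; apply.
  by move: wa; rewrite /at_t tn.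
move: wb; rewrite /before; case E : (t : nat) => [|s]// ns.
by apply/lt_trunc_tau; split => //; rewrite -ltnS -E ltn_ord.
Qed.

Lemma measurable_trunc_tau n (t : 'I_n.+1) :
  measurable (trunc_tau n @^-1` [set t]).
Proof. exact: (history_measurable (@history_trunc_tau n t)). Qed.

Lemma measurable_stopped_ratio n :
  measurable_fun setT (fun w => inv_ratio (trunc_tau n w) w).
Proof.
apply: (@measurable_fun_select _ Omega n.+1 (trunc_tau n) _ _ _
  (fun t : 'I_n.+1 => inv_ratio t)) => t.
  exact: measurable_trunc_tau.
exact: measurable_inv_ratio.
Qed.

(** The change of measure at the stopping time: apply [integral_inv_ratio] at
    time [t] to the part of [F] where [min (tau, n) = t]. *)
Lemma integral_stopped_ratio n F : measurable F ->
  (forall t : 'I_n.+1, history X t (F `&` trunc_tau n @^-1` [set t])) ->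
  \int[P]_(w in F) (inv_ratio (trunc_tau n w) w)%:E <= Q F.
Proof.
move=> mF hF.
rewrite (ge0_integral_partition (@measurable_trunc_tau n))//; last 2 first.
- by apply/measurable_EFinP; exact: measurable_stopped_ratio.
- by move=> w; rewrite lee_fin inv_ratio_ge0.
rewrite (measure_partition (@measurable_trunc_tau n) Q mF).
apply: lee_sum => t _.
rewrite (eq_integral (fun w => (inv_ratio t w)%:E)); last first.
  by move=> w; rewrite inE => -[_ /= ->].
rewrite integral_inv_ratio; last exact: hF.
have mFt : measurable (F `&` trunc_tau n @^-1` [set t]).
  exact: (history_measurable (hF t)).
have mR : measurable (regular t) by exact: (history_measurable (@history_regular t)).
by apply: le_measure; rewrite ?inE//; exact: measurableI.
Qed.

Hypothesis gi : forall a, (p a).-integrable setT (EFin \o g a).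
Hypothesis draw_regular : forall t a,
  P (drawn_running st t a) = 0 \/ p a (~` G a) = 0.

(** Up to the stopping time, an irregular reward would have to come from an arm
    of which either the draw or the irregular values have probability zero. *)
Lemma ae_regular n : {ae P, forall w, regular (trunc_tau n w) w}.
Proof.
pose bad s := ~` stopped_by st s `&` ~` [set w | G (arm st s.+1 w) (X s.+1 w)].
have mbad s : measurable (bad s).
  apply: measurableI; apply: measurableC; first exact: measurable_stopped_by.
  exact: (history_measurable (@history_regular_step s)).
have bad0 s : P (bad s) = 0.
  rewrite (measure_partition (@measurable_arm _ _ _ _ _ st s) P (mbad s)).
  apply: big1 => a _.
  have -> : bad s `&` arm st s.+1 @^-1` [set a] =
      ~` stopped_by st s `&` arm st s.+1 @^-1` [set a] `&` X s.+1 @^-1` (~` G a).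
    apply/seteqP; split=> w; rewrite /bad /=.
      by move=> [[ns nG] wa]; split => // Ga; apply: nG; rewrite wa.
    by move=> [[ns wa] nG]; split => //; split => //; rewrite wa.
  apply: etrans (lawP a (@history_running _ _ _ _ _ st s) (measurableC (mG a))) _.
  by have := draw_regular s a; rewrite /drawn_running => -[] ->; rewrite ?mul0e ?mule0.
have : {ae P, forall w, forall s, ~ bad s w}.
  apply: ae_foralln => s; exists (bad s); split; [exact: mbad|exact: bad0|].
  by move=> w /=; exact: contrapT.
apply: filterS => w wok; apply/regularP => s /lt_trunc_tau[_ ns].
by apply: contrapT => nG; exact: (wok s).
Qed.

(** The logarithm of the likelihood ratio at time [min (tau, n)], written as a
    sum over fixed times and arms so that it can be integrated termwise. *)
Definition log_ratio n w : R :=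
  (\sum_(s < n) \sum_a \1_(drawn_running st s a) w * g a (X s.+1 w))%R.

Lemma log_ratioE n w :
  log_ratio n w = (\sum_(s < trunc_tau n w) g (arm st s.+1 w) (X s.+1 w))%R.
Proof.
rewrite (big_ord_widen n (fun s => g (arm st s.+1 w) (X s.+1 w))); last first.
  by rewrite -ltnS ltn_ord.
rewrite [RHS]big_mkcond; apply: eq_bigr => s _.
rewrite (bigD1 (arm st s.+1 w))//= big1 ?addr0; last first.
  move=> a aw; rewrite indicE memNset ?mul0r// => -[_ /= wa].
  by rewrite wa eqxx in aw.
rewrite indicE; case: ifPn => [/lt_trunc_tau[_ ns]|sn].
  by rewrite mem_set ?mul1r.
rewrite memNset ?mul0r// => -[ns _].
by move/negP: sn; apply; apply/lt_trunc_tau.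
Qed.

(** Wald's identity: whether the strategy is running at time [s], and which arm
    it draws next, is decided by the past, hence independently of the reward. *)
Lemma integral_log_ratio n :
  P.-integrable setT (EFin \o log_ratio n) /\
  \int[P]_w (log_ratio n w)%:E =
  \sum_(s < n) \sum_a P (drawn_running st s a) * \int[p a]_x (g a x)%:E.
Proof.
have term s a :
    P.-integrable setT (fun w => (\1_(drawn_running st s a) w * g a (X s.+1 w))%:E) /\
    \int[P]_w (\1_(drawn_running st s a) w * g a (X s.+1 w))%:E =
    P (drawn_running st s a) * \int[p a]_x (g a x)%:E.
  have [gXi gXE] := reward_law_integral lawP (@history_running _ _ _ _ _ st s) (gi a).
  have mD := measurable_drawn_running st s a.
  have -> : (fun w => (\1_(drawn_running st s a) w * g a (X s.+1 w))%:E) =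
      (EFin \o (g a \o X s.+1)) \_ (drawn_running st s a).
    apply/funext => w; rewrite /patch indicE.
    by case: ifPn => _ /=; rewrite ?mul1r ?mul0r.
  by rewrite -integral_mkcond; split => //; exact/(integrable_mkcond _ mD).
have E : (fun w => (log_ratio n w)%:E) = (fun w => \sum_(s < n) \sum_a
    (\1_(drawn_running st s a) w * g a (X s.+1 w))%:E).
  by apply/funext => w; rewrite -sumEFin; apply: eq_bigr => s _; rewrite -sumEFin.
have si s : P.-integrable setT
    (fun w => \sum_a (\1_(drawn_running st s a) w * g a (X s.+1 w))%:E).
  by apply: integrable_sum => // a _; exact: (term s a).1.
split; first by rewrite /comp E; apply: integrable_sum => // s _; exact: si.
rewrite E integral_sum//; apply: eq_bigr => s _.
rewrite integral_sum//; last by move=> a; exact: (term s a).1.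
by apply: eq_bigr => a _; exact: (term s a).2.
Qed.

(** Integrate [1 + y <= exp y] at [y = c 1_B - ln L - ln m], where [L] is the
    likelihood ratio at time [min (tau, n)] and [B] is cut down to the runs
    stopped by time [n], so that it is known at that time. *)
Lemma transport_finite_horizon (B : set Omega) n (c m : R) : (0 < m)%R ->
  (forall t, history X t (B `&` stopped_by st t)) ->
  c%:E * P (B `&` stopped_by st n) + (1 - ln m)%:E <=
  \sum_(s < n) \sum_a P (drawn_running st s a) * \int[p a]_x (g a x)%:E +
  (m^-1)%:E * (Q (~` (B `&` stopped_by st n)) +
               (expR c)%:E * Q (B `&` stopped_by st n)).
Proof.
move=> m0 hB; set Bn := B `&` stopped_by st n.
have mBn : measurable Bn by exact: (history_measurable (hB n)).
pose f w : R := (c * \1_Bn w)%R.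
pose M w : R := inv_ratio (trunc_tau n w) w.
have mM : measurable_fun setT M by exact: measurable_stopped_ratio.
have M0 w : (0 <= M w)%R by exact: inv_ratio_ge0.
pose H w : R := (expR (f w) * M w)%R.
have mH : measurable_fun setT H.
  apply: measurable_funM => //; apply: measurableT_comp => //.
  by apply: measurable_funM => //; exact: measurable_indic.
have H0 w : (0 <= H w)%R by rewrite mulr_ge0 ?expR_ge0.
have hBn (t : 'I_n.+1) : history X t (Bn `&` trunc_tau n @^-1` [set t]).
  have -> : Bn `&` trunc_tau n @^-1` [set t] =
      (B `&` stopped_by st t) `&` trunc_tau n @^-1` [set t].
    apply/seteqP; split=> w /= [[Bw sw] tE]; split => //; split => //.
      by rewrite -tE; exact: (iffLR (trunc_tau_stopped n w)).
    by apply: (iffRL (trunc_tau_stopped n w)); rewrite tE.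
  exact: (historyI (hB t) (@history_trunc_tau n t)).
have hBnC (t : 'I_n.+1) : history X t (~` Bn `&` trunc_tau n @^-1` [set t]).
  have -> : ~` Bn `&` trunc_tau n @^-1` [set t] =
      ~` (Bn `&` trunc_tau n @^-1` [set t]) `&` trunc_tau n @^-1` [set t].
    apply/seteqP; split=> w /= [nBw tE]; split => //; first by move=> [].
    by move=> Bw; apply: nBw.
  exact: (historyI (historyC (hBn t)) (@history_trunc_tau n t)).
have HE : \int[P]_w (H w)%:E <= Q (~` Bn) + (expR c)%:E * Q Bn.
  rewrite -(setUv Bn) ge0_integral_setU//; last 4 first.
  - exact: measurableC.
  - by apply/measurable_EFinP/measurable_funTS.
  - by move=> w _; rewrite lee_fin.
  - by rewrite /disj_set setICr.
  rewrite addeC; apply: leeD.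
    rewrite (eq_integral (fun w => (M w)%:E)); last first.
      move=> w; rewrite inE => nB.
      by rewrite /H /f indicE memNset// mulr0 expR0 mul1r.
    by apply: integral_stopped_ratio => //; exact: measurableC.
  rewrite (eq_integral (fun w => (expR c)%:E * (M w)%:E)); last first.
    by move=> w wB; rewrite /H /f indicE wB mulr1 EFinM.
  rewrite ge0_integralZl_EFin ?expR_ge0//; last 2 first.
  - by move=> w _; rewrite lee_fin.
  - by apply/measurable_EFinP/measurable_funTS.
  by apply: lee_wpmul2l; rewrite ?lee_fin ?expR_ge0//; exact: integral_stopped_ratio.
have H_ge0 w : 0 <= (H w)%:E by rewrite lee_fin.
have Hi : P.-integrable setT (EFin \o H).
  apply/integrableP; split; first exact/measurable_EFinP.
  under eq_integral do rewrite /= ger0_norm//.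
  apply: le_lt_trans HE _; rewrite -ge0_fin_numE; last first.
    by rewrite adde_ge0// mule_ge0// lee_fin expR_ge0.
  rewrite fin_numD; apply/andP; split.
    by rewrite fin_num_measure//; exact: measurableC.
  by rewrite fin_numM// fin_num_measure.
have [Zi ZE] := integral_log_ratio n.
have fi : P.-integrable setT (EFin \o f).
  rewrite (_ : EFin \o f = fun w => c%:E * (\1_Bn w)%:E); last first.
    by apply/funext => w; rewrite -EFinM.
  exact/integrableZl/integrable_indic.
have ci : P.-integrable setT (EFin \o cst (1 - ln m)%R).
  exact: finite_measure_integrable_cst.
have -> : c%:E * P Bn + (1 - ln m)%:E =
    \int[P]_w ((f w)%:E + (cst (1 - ln m)%R w)%:E).
  rewrite integralD//; congr (_ + _).
    rewrite (eq_integral (fun w => c%:E * (\1_Bn w)%:E)); last first.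
      by move=> w _; rewrite -EFinM.
    by rewrite integralZl ?integral_indic ?setIT//; exact: integrable_indic.
  rewrite (integral_cst P measurableT (1 - ln m)%:E).
  by rewrite [X in _ * X](probability_setT P) mule1.
have Hmi : P.-integrable setT (fun w => (m^-1)%:E * (H w)%:E) by exact: integrableZl.
apply: (@le_trans _ _ (\int[P]_w ((log_ratio n w)%:E + (m^-1)%:E * (H w)%:E))).
  apply: ae_le_integral; [exact: integrableD|exact: integrableD|].
  have := ae_regular n; apply: filterS => w reg.
  rewrite -!EFinD lee_fin /=.
  rewrite /H /M inv_ratioE// -log_ratioE -expRD.
  have -> : (m^-1 = expR (- ln m))%R by rewrite expRN lnK.
  rewrite -expRD; set y := (- ln m + _)%R.
  by have := expR_ge1Dx y; rewrite /y; lra.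
rewrite integralD// ZE leeD2l// integralZl//.
by apply: lee_wpmul2l => //; rewrite lee_fin invr_ge0 ltW.
Qed.

End LikelihoodProcess.

(** * The transport inequality *)

Section Transport.
Context d (Omega : measurableType d) (R : realType) (K : nat).
Variable X : nat -> {mfun Omega >-> measurableTypeR R}.
Variable st : strategy K X.
Implicit Types (p q : 'I_K -> probability (measurableTypeR R) R).
Implicit Types (P Q : probability Omega R).
Local Open Scope ereal_scope.

(** The expected number of draws of an arm before stopping: the arm chosen at
    time [t+1] counts when the strategy has not stopped by time [t]. *)
Definition expected_draws P a : \bar R :=
  \sum_(t <oo) P (drawn_running st t a).

Lemma expected_draws_ge0 P a : 0 <= expected_draws P a.
Proof. exact: nneseries_ge0. Qed.

(** [tau] counts the times [t] at which the strategy is still running. *)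
Lemma tau_erealE w : tau_ereal st w = \sum_(t <oo) (\1_(~` stopped_by st t) w)%:E.
Proof.
have ind t : \1_(~` stopped_by st t) w =
    (if tau st w is Some k then (t < k)%N else true)%:R :> R.
  rewrite indicE /stopped_by; case E : (tau st w) => [k|].
    congr (_%:R); congr nat_of_bool; apply/idP/idP => [/set_mem /= nk|tk].
      by rewrite ltnNge; apply/negP => kt; apply: nk; exists k.
    by apply/mem_set => -[k']; rewrite /= E => -[<-]; rewrite leqNgt tk.
  by rewrite mem_set// => -[k']; rewrite /= E.
rewrite /tau_ereal; apply/esym/cvg_lim => //.
move: ind; case: (tau st w) => [k|] ind.
  apply: cvg_near_cst; exists k => // n /= kn.
  rewrite sumEFin; congr EFin; rewrite (big_cat_nat (n := k))//=.
  rewrite [X in (_ + X)%R]big_nat_cond [X in (_ + X)%R]big1; last first.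
    by move=> t /andP[/andP[kt _] _]; rewrite ind ltnNge kt.
  rewrite addr0 big_nat_cond (eq_bigr (fun=> 1%R)); last first.
    by move=> t /andP[/andP[_ tk] _]; rewrite ind tk.
  by rewrite -big_nat_cond big_const_nat iter_addr_0 subn0.
apply/cvgeyPge => A; exists (Num.bound A) => // n /= An.
rewrite sumEFin lee_fin (eq_bigr (fun=> 1%R)) => [|t _]; last by rewrite ind.
rewrite big_const_nat iter_addr_0 subn0.
apply: (le_trans (ler_norm A)); apply: (le_trans (ltW (archi_boundP _))) => //.
by rewrite /Num.bound normr_id ler_nat.
Qed.

Lemma bigcup_stopped_by :
  \bigcup_n stopped_by st n = [set w | tau st w <> None].
Proof.
apply/seteqP; split=> w /=; first by move=> [n _ [k ->]].
by case E : (tau st w) => [k|]// _; exists k => //; exists k.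
Qed.

Lemma integral_tau P :
  \int[P]_w tau_ereal st w = \sum_a expected_draws P a.
Proof.
have mS t := @measurable_stopped_by _ _ _ _ _ st t.
rewrite (eq_integral (fun w => \sum_(t <oo) (\1_(~` stopped_by st t) w)%:E)); last first.
  by move=> w _; exact: tau_erealE.
rewrite integral_nneseries//; last first.
  by move=> t; apply/measurable_EFinP/measurable_indic/measurableC.
rewrite /expected_draws -nneseries_sum//; apply: eq_eseriesr => t _.
rewrite integral_indic ?setIT//; last exact: measurableC.
by apply: measure_partition; [exact: measurable_arm|exact: measurableC].
Qed.

(** Passage from log-densities to divergences.  An arm of infinite divergence
    has no integrable log-density, but the hypothesis says that it is almost
    surely not drawn before stopping; giving it the empty regular set and the
    function [0] keeps all hypotheses of [transport_finite_horizon]. *)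
Lemma transport_horizon_KL p q P Q (B : set Omega) n (c m : R) :
  reward_law st p P -> reward_law st q Q ->
  (forall a, KL (p a) (q a) < +oo \/ forall t, P (drawn_running st t a) = 0) ->
  (0 < m)%R -> (forall t, history X t (B `&` stopped_by st t)) ->
  c%:E * P (B `&` stopped_by st n) + (1 - ln m)%:E <=
  \sum_a expected_draws P a * KL (p a) (q a) +
  (m^-1)%:E * (Q (~` (B `&` stopped_by st n)) +
               (expR c)%:E * Q (B `&` stopped_by st n)).
Proof.
move=> lawP lawQ KLfin m0 hB.
have armP a : exists gG : (measurableTypeR R -> R) * set (measurableTypeR R),
    [/\ measurable gG.2, (p a).-integrable setT (EFin \o gG.1),
        forall B, measurable B ->
          \int[p a]_(x in B) (expR (- gG.1 x) * \1_(gG.2) x)%:E = q a (B `&` gG.2),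
        (forall t, P (drawn_running st t a) = 0) \/ p a (~` gG.2) = 0 &
        (forall t, P (drawn_running st t a) = 0) \/
           \int[p a]_x (gG.1 x)%:E = KL (p a) (q a)].
  have [KLoo|D0] := KLfin a.
    have [g [G [mG pG gi gE ratio]]] := KL_log_density KLoo.
    by exists (g, G); split => //; right.
  exists (cst 0%R, set0); split => /=; [exact: measurable0| | |by left|by left].
    exact: finite_measure_integrable_cst.
  move=> B' mB'; rewrite setI0 measure0 integral0_eq// => x _.
  by rewrite indicE in_set0 mulr0.
have [gG gGP] := choice armP.
pose g a := (gG a).1; pose G a := (gG a).2.
have mG a : measurable (G a) by have [] := gGP a.
have gi a : (p a).-integrable setT (EFin \o g a) by have [] := gGP a.
have mg a : measurable_fun setT (g a).
  by have /measurable_EFinP := measurable_int _ (gi a).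
have ratio a (B' : set (measurableTypeR R)) : measurable B' ->
    \int[p a]_(x in B') (step_ratio g G a x)%:E = q a (B' `&` G a).
  by have [_ _ + _ _] := gGP a; apply.
have regG t a : P (drawn_running st t a) = 0 \/ p a (~` G a) = 0.
  by have [_ _ _ [D0|pG] _] := gGP a; [left; exact: D0|right].
have := @transport_finite_horizon _ _ _ _ _ st g G mg mG p q P Q lawP lawQ
  ratio gi regG B n c m m0 hB.
move/le_trans; apply; apply: leeD2r.
rewrite exchange_big /=; apply: lee_sum => a _.
have -> : \sum_(s < n) P (drawn_running st s a) * \int[p a]_x (g a x)%:E =
    \sum_(s < n) P (drawn_running st s a) * KL (p a) (q a).
  apply: eq_bigr => s _; have [_ _ _ _ [D0|gE]] := gGP a.
    by rewrite D0 !mul0e.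
  by rewrite gE.
rewrite -ge0_sume_distrl//; apply: lee_wpmul2r; first exact: KL_ge0.
by rewrite -(big_mkord xpredT (fun s => P (drawn_running st s a)));
   exact: nneseries_lim_ge.
Qed.

Lemma kl_symm (delta : R) : (0 < delta < 1)%R ->
  kl delta (1 - delta) = (- (1 - 2 * delta) * ln (delta / (1 - delta)))%R.
Proof.
move=> /andP[d0 d1]; rewrite /kl.
have -> : (1 - (1 - delta) = delta)%R by ring.
have -> : ((1 - delta) / delta = (delta / (1 - delta))^-1)%R by rewrite invf_div.
by rewrite lnV ?posrE ?divr_gt0 ?subr_gt0//; ring.
Qed.

(** If an arm of infinite divergence is drawn with positive probability the
    right-hand side is infinite.  Otherwise [transport_horizon_KL], with the
    optimal [m] and [c], bounds [Q (B and tau <= n)] by a constant [ub]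
    independent of [n]; the limit gives [1 - delta <= ub], which is the claim
    after clearing the denominator [1 - m ^ 2].  That denominator vanishes for
    [delta = 1/2], where the left-hand side is zero. *)
Lemma kl_transport p q P Q (B : set Omega) (delta : R) :
  reward_law st p P -> reward_law st q Q ->
  (0 < delta)%R -> (delta <= 2^-1)%R ->
  measurable B -> (forall t, history X t (B `&` stopped_by st t)) ->
  Q [set w | tau st w <> None] = 1 ->
  P B <= delta%:E -> (1 - delta)%:E <= Q B ->
  (kl delta (1 - delta))%:E <= \sum_a expected_draws P a * KL (p a) (q a).
Proof.
move=> lawP lawQ d0 d2 mB hB Qtau PB QB.
have d1 : (delta < 1)%R by lra.
have term0 a : 0 <= expected_draws P a * KL (p a) (q a).
  by rewrite mule_ge0 ?expected_draws_ge0 ?KL_ge0.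
have [[a [KLoo drawn]]|KLfin] := pselect (exists a,
    KL (p a) (q a) = +oo /\ expected_draws P a != 0).
  rewrite (bigD1 a)//= KLoo gt0_muley; last first.
    by rewrite lt0e drawn expected_draws_ge0.
  by rewrite addye ?leey// gt_eqF// (lt_le_trans (ltNyr 0))// sume_ge0.
have {}KLfin a : KL (p a) (q a) < +oo \/ forall t, P (drawn_running st t a) = 0.
  have [|] := ltP (KL (p a) (q a)) +oo; first by left.
  rewrite leye_eq => /eqP KLoo; right => t.
  have /eqP D0 : expected_draws P a == 0.
    by apply/negP => D0; apply: KLfin; exists a; split => //; exact/negP.
  apply/eqP; rewrite eq_le measure_ge0 andbT -D0.
  apply: le_trans (nneseries_lim_ge t.+1 _); last by [].
  by rewrite big_nat_recr//= leeDr// sume_ge0.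
set m := (delta / (1 - delta))%R.
have m0 : (0 < m)%R by rewrite divr_gt0// subr_gt0.
rewrite kl_symm ?d0//; set D := \sum_a _.
have D0 : 0 <= D by exact: sume_ge0.
have := fun n => transport_horizon_KL n (2 * ln m)%R lawP lawQ KLfin m0 hB.
rewrite -/D; case: D D0 => [r r0|_ _|//]; last exact: leey.
have [d12|d12] := eqVneq delta 2^-1%R.
  by move=> _; rewrite (_ : (1 - 2 * delta = 0)%R) ?oppr0 ?mul0r//; rewrite d12; lra.
move=> hn.
have d2' : (delta < 2^-1)%R by rewrite lt_neqAle d12.
have m1 : (m < 1)%R by rewrite ltr_pdivrMr ?subr_gt0// mul1r; lra.
have mE : (m * (1 - delta) = delta)%R by rewrite divfK// subr_eq0 gt_eqF.
have lnm0 : (ln m <= 0)%R by rewrite ln_le0// ltW.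
have e0 : (0 < 1 - m ^+ 2)%R by rewrite subr_gt0 exprn_ilt1// ltW.
set B_ := fun n => B `&` stopped_by st n.
have mB_ n : measurable (B_ n) by exact: (history_measurable (hB n)).
pose ub := ((1 - m * (2 * ln m * delta + 1 - ln m - r)) / (1 - m ^+ 2))%R.
have Qub n : Q (B_ n) <= ub%:E.
  have := hn n; rewrite -/(B_ n) expRM_natl lnK// probability_setC//.
  have PBn : P (B_ n) <= delta%:E.
    by apply: le_trans PB; apply: le_measure; rewrite ?inE// => w [].
  have : P (B_ n) \is a fin_num by rewrite fin_num_measure.
  have : Q (B_ n) \is a fin_num by rewrite fin_num_measure.
  move: PBn; case: (P (B_ n)) => [a| |]//; case: (Q (B_ n)) => [b| |]//.
  move=> + _ _.
  rewrite lee_fin -EFinB -!(EFinM, EFinD) !lee_fin => ad h.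
  rewrite /ub ler_pdivlMr//.
  have h1 : (2 * ln m * delta <= 2 * ln m * a)%R.
    by rewrite ler_wnM2l//; lra.
  have h2 : (m * (2 * ln m * delta + 1 - ln m - r) <=
             m * (m^-1 * (1 - b + m ^+ 2 * b)))%R.
    by rewrite ler_pM2l//; lra.
  by move: h2; rewrite mulrA divff ?gt_eqF// mul1r; lra.
have QBub : Q B <= ub%:E.
  have -> : Q B = Q (\bigcup_n B_ n).
    rewrite /B_ -setI_bigcupr.
    have mtau : measurable [set w | tau st w <> None].
      rewrite -bigcup_stopped_by.
      by apply: bigcupT_measurable => n; exact: measurable_stopped_by.
    rewrite bigcup_stopped_by.
    have Qcomp : Q (~` [set w | tau st w <> None]) = 0.
      by rewrite probability_setC// Qtau subee.
    rewrite (measureDI Q mB mtau) [X in X + _](_ : _ = 0) ?add0e//.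
    apply: subset_measure0 Qcomp => //; first exact: measurableD.
    exact: measurableC.
  have cvgB : Q \o B_ @ \oo --> Q (\bigcup_n B_ n).
    apply: nondecreasing_cvg_mu => //; first exact: bigcupT_measurable.
    move=> i j ij; apply/subsetPset => w [Bw [k tk ki]]; split => //.
    by exists k => //; exact: leq_trans ki ij.
  rewrite -(cvg_lim _ cvgB)//; apply: lime_le.
    by apply/cvg_ex; exists (Q (\bigcup_n B_ n)).
  by apply: nearW => n; exact: Qub.
have := le_trans QB QBub; rewrite !lee_fin /ub ler_pdivlMr// => h.
have h' : (m * (2 * ln m * delta - ln m) <= m * r)%R.
  have E : ((1 - delta) * (1 - m ^+ 2) = 1 - delta - m * (m * (1 - delta)))%R.
    by ring.
  rewrite E mE in h.
  have : (m - m * delta = delta)%R by rewrite -[RHS]mE; ring.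
  by lra.
by rewrite ler_pM2l// in h'; lra.
Qed.

End Transport.

(** * The characteristic time *)

Section CharacteristicTime.
Context {R : realType} {K : nat} (E : exp_family R).
Implicit Types (S : set ('I_K -> R)) (mu lambda : 'I_K -> R).
Local Open Scope ereal_scope.

Lemma divergence_ge0 (x y : R) : 0 <= divergence E x y.
Proof. exact: KL_ge0. Qed.

(** The weights [n / \sum_a n a] compete in the supremum [Tstar_inv], and the
    hypothesis says that their infimum over [Alt] is at least
    [k / \sum_a n a].  The total is zero only if [Alt] is empty or [k = 0];
    when [Alt] is empty, [Tstar] is zero. *)
Lemma Tstar_mul_le S mu (a0 : 'I_K) (n : 'I_K -> \bar R) (k : R) :
  (forall a, 0 <= n a) -> (0 <= k)%R ->
  (forall lambda, Alt S mu lambda ->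
     k%:E <= \sum_a n a * divergence E (mu a) (lambda a)) ->
  Tstar E S mu * k%:E <= \sum_a n a.
Proof.
move=> n0 k0 nk.
have sum0 : 0 <= \sum_a n a by exact: sume_ge0.
have [->|kN0] := eqVneq k 0%R; first by rewrite mule0.
have {kN0}k_gt0 : (0 < k)%R by rewrite lt_neqAle eq_sym kN0.
have [[lambda0 alt0]|noalt] := pselect (exists lambda, Alt S mu lambda); last first.
  rewrite /Tstar (_ : Tstar_inv E S mu = +oo) ?invey ?mul0e//.
  apply/eqP; rewrite -leye_eq; apply: ereal_sup_ubound.
  exists (fun a => (a == a0)%:R).
    split=> [a|]; first by rewrite ler0n.
    by rewrite (bigD1 a0)//= eqxx big1 ?addr0// => a /negbTE ->.
  rewrite (_ : [set _ | _ in _] = set0) ?ereal_inf0//.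
  apply/seteqP; split=> // x [lambda alt _].
  by apply: noalt; exists lambda.
case sumE : (\sum_a n a) sum0 => [r| |] r0 //; last exact: leey.
have n_le a : n a <= r%:E by rewrite -sumE (bigD1 a)//= leeDl// sume_ge0.
have n_fin a : n a \is a fin_num.
  by rewrite ge0_fin_numE//; exact: le_lt_trans (n_le a) (ltry r).
have r_gt0 : (0 < r)%R.
  rewrite lt_neqAle -lee_fin r0 andbT; apply/eqP => r00.
  have := nk _ alt0; rewrite big1 ?lee_fin ?leNgt ?k_gt0// => a _.
  have := n_le a; rewrite -r00 => na0.
  by rewrite (_ : n a = 0) ?mul0e//; apply/eqP; rewrite eq_le na0 n0.
pose w a := (fine (n a) / r)%R.
have wE a : r%:E * (w a)%:E = n a.
  by rewrite -EFinM /w mulrC divfK ?gt_eqF// fineK.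
have : (k / r)%:E <= Tstar_inv E S mu.
  apply: le_ereal_sup_tmp; exists (ereal_inf [set \sum_a (w a)%:E *
      divergence E (mu a) (lambda a) | lambda in Alt S mu]).
    exists w => //; split=> [a|].
      by rewrite divr_ge0 ?fine_ge0// ltW.
    rewrite -mulr_suml sum_fine// sumE /= divff// gt_eqF//.
  apply: le_ereal_inf_tmp => _ [lambda /nk knl <-].
  rewrite -(@lee_pmul2l _ r%:E)// -EFinM mulrC divfK ?gt_eqF//.
  apply: le_trans knl _; rewrite ge0_sume_distrr.
    by apply: lee_sum => a _; rewrite muleA wE.
  by move=> a _; rewrite mule_ge0 ?divergence_ge0// lee_fin divr_ge0 ?fine_ge0// ltW.
rewrite /Tstar; case: (Tstar_inv E S mu) => [t| |]//; last by rewrite invey mul0e.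
rewrite lee_fin => krt.
have t0 : (0 < t)%R by apply: lt_le_trans krt; rewrite divr_gt0.
rewrite inver gt_eqF// -EFinM lee_fin mulrC ler_pdivrMr// mulrC.
by move: krt; rewrite ler_pdivrMr.
Qed.

End CharacteristicTime.

Lemma kl_symm_ge0 (R : realType) (delta : R) :
  0 < delta < 1 -> delta <= 2^-1 -> 0 <= kl delta (1 - delta).
Proof.
move=> /andP[d0 d1] d2; rewrite kl_symm ?d0// mulNr oppr_ge0.
rewrite mulr_ge0_le0 ?ln_le0//; first by lra.
by rewrite ler_pdivrMr ?subr_gt0// mul1r; lra.
Qed.

Section Decision.
Context d (Omega : measurableType d) (R : realType) (K : nat).
Variable X : nat -> {mfun Omega >-> measurableTypeR R}.
Variable st : strategy K X.

Lemma decision_preimage (D : set 'I_K) :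
  [set w | D (decision st w)] = \bigcup_(a in D) (decision st @^-1` [set a]).
Proof.
by apply/seteqP; split=> [w Dw|w [a Da /= ->]//]; exists (decision st w).
Qed.

Lemma measurable_decision (D : set 'I_K) :
  measurable [set w | D (decision st w)].
Proof.
rewrite decision_preimage; apply: fin_bigcup_measurable => // a _.
exact: decision_measurable.
Qed.

Lemma history_decision (D : set 'I_K) t :
  history X t ([set w | D (decision st w)] `&` stopped_by st t).
Proof.
rewrite decision_preimage setI_bigcupl.
apply: (@fin_bigcup_measurable _ (past X t)) => // a _.
exact: (decision_stopped st a (t := t)).
Qed.

End Decision.

Unset Implicit Arguments.

(** * The lower bound *)

Theorem theorem1 (R : realType) (E : exp_family R) (K : nat)
    (S : set ('I_K -> R))
    (hS : forall mu, S mu ->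
       bandit_model E mu /\ exists a : 'I_K, unique_optimal mu a)
    (delta : R) (hdelta : 0 < delta < 1) (hdelta2 : delta <= 2^-1)
    (d : measure_display) (Omega : measurableType d)
    (X : nat -> {mfun Omega >-> measurableTypeR R})
    (st : strategy K X)
    (P : ('I_K -> R) -> probability Omega R)
    (hP : forall mu, S mu -> bandit_law st E mu (P mu))
    (hPAC : PAC st P S delta)
    (mu : 'I_K -> R) (hmu : S mu) :
  (Tstar E S mu * (kl delta (1 - delta))%:E
     <= \int[P mu]_w tau_ereal st w)%E.
Proof.
have [_ [a0 _]] := hS mu hmu.
rewrite integral_tau; apply: (@Tstar_mul_le R K E S mu a0).
- by move=> a; exact: expected_draws_ge0.
- exact: kl_symm_ge0.
move=> lambda [Slambda astarN].
pose D : set 'I_K := [set a | Some a <> astar mu].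
apply: (@kl_transport _ _ _ _ _ st _ _ _ (P lambda) [set w | D (decision st w)]).
- exact: hP.
- exact: hP.
- by case/andP: hdelta.
- exact: hdelta2.
- exact: measurable_decision.
- by move=> t; exact: history_decision.
- exact: (hPAC lambda Slambda).1.
- exact: (hPAC mu hmu).2.
have mdec := measurable_decision st [set a | Some a <> astar lambda].
(* A decision for the best arm of [mu] is an error under [lambda]. *)
rewrite -[X in (_ <= P lambda X)%E]setCK probability_setC; last first.
  exact/measurableC/measurable_decision.
rewrite EFinB; apply: leeB => //.
apply: le_trans (hPAC lambda Slambda).2; apply: le_measure; rewrite ?inE//.
  exact/measurableC/measurable_decision.
by move=> w /= /contrapT ->; exact: nesym.
Qed.
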